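(* Let $f:\mathrm{I}\to\mathbb{R}$ be a convex function on an interval $\mathrm{I}\subseteq\mathbb{R}$, let $\Gamma\subseteq\mathcal{M}_b(\mathcal{H})$, let $\P\in\mathcal{P}(\mathcal{H})$ be a fixed distribution (not depending on the sample), let $\delta\in[0,1]$, and for every sample $\mathcal{S}\in\mathcal{Z}^m$ let $\phi_{\mathcal{S}}\in\Gamma$. Assume there exists a function $B^{\P}$ such that for any $\mathcal{S}$ and $\P$, $\Lambda^{\P}_f(\phi_{\mathcal{S}})\le B^{\P}(\phi_{\mathcal{S}})$. Assume moreover the bounded-difference property: there are constants $c_1,\dots,c_m$ such that for all $i\in\{1,\dots,m\}$, \[ \sup_{\mathcal{S}\in\mathcal{Z}^m,\ z_i'\in\mathcal{Z}}\big|B^{\P}(\phi_{\mathcal{S}})-B^{\P}(\phi_{\mathcal{S}'_i})\big|\le c_i, \] where $\mathcal{S}'_i$ is the sample $\mathcal{S}$ with $z_i$ replaced by $z_i'$. Then with probability at least $1-\delta$ over $\mathcal{S}\sim\mathcal{D}^m$, for all $\rho\in\mathcal{P}(\mathcal{H})$, \[ \mathbb{E}_{h\sim\rho}\phi_{\mathcal{S}}(h)\le D^{\Gamma}_f(\rho\|\P)+\mathbb{E}_{\mathcal{S}\sim\mathcal{D}^m}B^{\P}(\phi_{\mathcal{S}})+\sqrt{\frac{\ln\frac{1}{\delta}}{2}\sum_{i=1}^m c_i^2}. \]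
   Context: $\mathcal{H}$ is a hypothesis space, $\mathcal{Z}$ a data space, $\mathcal{D}$ an unknown distribution on $\mathcal{Z}$, and $\mathcal{S}=\{z_1,\dots,z_m\}\sim\mathcal{D}^m$ an i.i.d. sample. $\mathcal{P}(\mathcal{H})$ is the set of probability distributions on $\mathcal{H}$ and $\mathcal{M}_b(\mathcal{H})$ the set of bounded measurable functions $\mathcal{H}\to\mathbb{R}$. $f^*(y)=\sup_{x\in\mathrm{I}}\{xy-f(x)\}$ is the Legendre transform of $f$. For $\varphi\in\mathcal{M}_b(\mathcal{H})$, $\Lambda^{\P}_{f}(\varphi):=\inf_{c\in\mathbb{R}}\{c+\mathbb{E}_{h\sim\P}f^*(\varphi(h)-c)\}$. The $(f,\Gamma)$-divergence is $D^{\Gamma}_f(\rho\|\P):=\sup_{\varphi\in\Gamma}\{\mathbb{E}_{h\sim\rho}\varphi(h)-\Lambda^{\P}_f(\varphi)\}$.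
   Formalization: The formal theorem takes δ in (0,1] rather than [0,1], since ln(1/δ) is undefined at δ = 0, and assumes that S ↦ B^P(φ_S) is measurable, without which its expectation over D^m is undefined. *)

(* Defs.v *)
From HB Require Import structures.
From mathcomp Require Import all_boot all_order all_algebra.
From mathcomp Require Import all_classical all_reals all_analysis.

Set Implicit Arguments.
Unset Strict Implicit.
Unset Printing Implicit Defensive.

Import Order.TTheory GRing.Theory Num.Theory.
Import numFieldNormedType.Exports.

Local Open Scope classical_set_scope.
Local Open Scope ring_scope.

Definition Mb (dH : measure_display) (H : measurableType dH) (R : realType)
  : set (H -> R) :=
  [set phi : H -> R | measurable_fun [set: H] phi /\ exists M : R, forall h, `|phi h| <= M].

Definition legendre (R : realType) (I : interval R) (f : R -> R) (y : R) : \bar R :=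
  ereal_sup [set ((x * y - f x)%:E) | x in [set` I]].

Definition LambdaP (dH : measure_display) (H : measurableType dH) (R : realType)
  (I : interval R) (f : R -> R) (P : probability H R) (phi : H -> R) : \bar R :=
  ereal_inf [set (c%:E + \int[P]_h legendre I f (phi h - c))%E | c in [set: R]].

Definition fGammaDiv (dH : measure_display) (H : measurableType dH) (R : realType)
  (I : interval R) (f : R -> R) (Gamma : set (H -> R))
  (rho P : probability H R) : \bar R :=
  ereal_sup [set (\int[rho]_h (phi h)%:E - LambdaP I f P phi)%E | phi in Gamma].

Definition replace_at (Z : Type) (m : nat) (S : m.-tuple Z) (i : 'I_m) (z' : Z)
  : m.-tuple Z :=
  [tuple (if j == i then z' else tnth S j) | j < m].

(** Dm is the m-fold product D^m of D: it agrees with the product of the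
    marginals on all measurable rectangles (this determines it uniquely,
    since rectangles form a pi-system generating the tuple sigma-algebra). *)
Definition is_product_measure (dZ : measure_display) (Z : measurableType dZ)
  (R : realType) (m : nat) (D : probability Z R) (Dm : probability (m.-tuple Z) R)
  : Prop :=
  forall A : 'I_m -> set Z, (forall i, measurable (A i)) ->
    Dm [set S | forall i, A i (tnth S i)] = (\prod_(i < m) D (A i))%E.

(* Main.v *)
(* Write g S = B (phi_S).  Taking phi_S itself as a test function in the
   variational formula for the divergence gives
   E_rho phi_S <= D(rho || P) + Lambda(phi_S) <= D(rho || P) + g S
   for every rho at once, so it remains to control g S from above by
   McDiarmid's inequality.  That is proved through the exponential moment:
   integrating out one coordinate at a time, Hoeffding's lemma contributes a
   factor exp(s^2 c_i^2 / 8) for the i-th coordinate, and Chernoff's bound with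
   s = 4 t / sum_i c_i^2 turns the product into exp(- 2 t^2 / sum_i c_i^2). *)
Require Import Defs.
From HB Require Import structures.
From mathcomp Require Import all_boot all_order all_algebra.
From mathcomp Require Import all_classical all_reals all_analysis.
From mathcomp Require Import measurable_realfun ring lra.

Import Order.TTheory GRing.Theory Num.Theory.
Import numFieldNormedType.Exports.

Local Open Scope classical_set_scope.
Local Open Scope ring_scope.

Set Implicit Arguments.
Unset Strict Implicit.

(** * Elementary inequalities for the exponential *)

Lemma le0_is_derive_le (R : realType) (F dF : R -> R) (h : R) :
  (forall x : R, is_derive x 1 F (dF x)) -> (forall x, 0 <= x -> dF x <= 0) ->
  0 <= h -> F h <= F 0.
Proof.
move=> dFE dF0 h0.
have cF : {within `[0, h], continuous F}.
  apply: continuous_subspaceT => x.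
  by apply/differentiable_continuous/derivable1_diffP; have [] := dFE x.
have [x + Fh] := MVT_segment h0 (fun x _ => dFE x) cF.
rewrite in_itv/= => /andP[x0 _].
by rewrite -subr_le0 Fh subr0 mulr_le0_ge0// dF0.
Qed.

(* The logarithm of the left-hand side has second derivative q (1 - q) <= 1/4
   in h, where q is the weight p e^h / (1 - p + p e^h). *)
Lemma bernoulli_mgf_le (R : realType) (p h : R) : 0 <= p <= 1 -> 0 <= h ->
  1 - p + p * expR h <= expR (p * h + h ^+ 2 / 8).
Proof.
move=> /andP[p0 p1].
pose N (x : R) : R := 1 - p + p * expR x.
have N_gt0 x : 0 < N x.
  rewrite /N; have := expR_gt0 x; move: p0; rewrite le_eqVlt => /predU1P[<-|p0] e0.
    by rewrite mul0r subr0 addr0.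
  by rewrite ltr_wpDl ?subr_ge0// mulr_gt0.
have N_neq0 x : N x != 0 by rewrite gt_eqF.
have dN (x : R) : is_derive x 1 N (p * expR x).
  have : is_derive x 1 (cst (1 - p) + p \*: (expR : R -> R)) (0 + p *: expR x).
    exact: is_deriveD.
  by rewrite add0r.
(* The fraction is the weight q, the derivative of the logarithm of [N]. It equals [p] at 0 and its
   slope is at most 1/4 on the half-line. *)
have q_le x : 0 <= x -> p * expR x / N x - (p + x / 4) <= 0.
  move=> x0.
  pose q (x : R) : R := p * expR x / N x - (p + x / 4).
  pose dq (x : R) : R := (p * expR x * N x - (p * expR x) ^+ 2) / N x ^+ 2 - 1 / 4.
  have -> : 0 = q 0.
    by rewrite /q /N expR0 mulr1 subrK divr1 mul0r addr0 subrr.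
  apply: (@le0_is_derive_le _ q dq) => // y.
    have dinv : is_derive y 1 (fun x => (N x)^-1) (- N y ^- 2 *: (p * expR y)).
      exact: is_deriveV.
    have dM : is_derive y 1 ((p \*: (expR : R -> R)) * (fun x => (N x)^-1))
        ((p \*: (expR : R -> R)) y *: (- N y ^- 2 *: (p * expR y))
          + (N y)^-1 *: (p *: expR y)).
      exact: is_deriveM.
    have dL : is_derive y 1 (cst p + (4^-1) \*: (id : R -> R)) (0 + 4^-1 *: 1).
      exact: is_deriveD.
    have -> : q = (p \*: (expR : R -> R)) * (fun x => (N x)^-1)
        - (cst p + (4^-1) \*: (id : R -> R)).
      by apply/funext => z; rewrite /q /=; congr (_ - (_ + _)); rewrite mulrC.
    apply: (is_derive_eq (is_deriveB dM dL)).
    rewrite /dq /= /GRing.scale/= add0r mulr1 mul1r; congr (_ - _).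
    by field.
  move=> _; rewrite /dq subr_le0 ler_pdivrMr ?exprn_gt0//.
  (* With a = p e^x, this square gives 4 a (N - a) <= N^2, which is q (1 - q) <= 1/4. *)
  have := sqr_ge0 (N y - 2 * (p * expR y)).
  nra.
move=> h0.
(* The quotient of the two sides replaces the difference of logarithms: [G 0] is 1, and by [q_le]
   the derivative [dG] is nonpositive for [0 <= x]. *)
pose G (x : R) : R := N x * expR (- (p * x + x ^+ 2 / 8)).
pose dG (x : R) : R := (p * expR x - (p + x / 4) * N x)
  * expR (- (p * x + x ^+ 2 / 8)).
suff : G h <= G 0.
  rewrite /G /N expR0 !mulr0 add0r expr0n mul0r oppr0 expR0 !mulr1 subrK.
  by rewrite expRN ler_pdivrMr ?expR_gt0// mul1r.
apply: (@le0_is_derive_le _ G dG) => // x; last first.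
  move=> x0; rewrite /dG pmulr_lle0 ?expR_gt0//.
  by have := q_le x x0; rewrite !subr_le0 ler_pdivrMr.
pose u : R -> R := - (p \*: (id : R -> R) + 8^-1 \*: (id : R -> R) ^+ 2).
have du : is_derive x 1 u (- (p *: 1 + 8^-1 *: ((2%:R * x ^+ 1) *: 1))).
  exact: is_deriveN.
have de : is_derive x 1 (expR \o u)
   (expR (u x) * (- (p *: 1 + 8^-1 *: ((2%:R * x ^+ 1) *: 1)))).
  exact: is_derive1_comp.
have -> : G = N * (expR \o u).
  apply/funext => z; rewrite /G /u /= mulrfctE; congr (_ * expR (- (_ + _))).
  by rewrite mulrC.
apply: is_derive_eq.
rewrite /dG /GRing.scale/= !mulr1 expr1.
have -> : u x = - (p * x + x ^+ 2 / 8).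
  by rewrite /u /=; congr (- (_ + _)); rewrite mulrC.
by field.
Qed.

(** Convexity from tangents: the tangent to exp at [t * h] lies below exp at 0 and at [h]. Weighting
    these two inequalities by [1 - t] and [t] cancels the slope terms. *)
Lemma expR_le_chord (R : realType) (t h : R) : 0 <= t <= 1 ->
  expR (t * h) <= 1 - t + t * expR h.
Proof.
move=> /andP[t0 t1].
have e0 := expR_gt0 (t * h).
have : expR (t * h) * (1 - t * h) <= 1.
  by rewrite -[leRHS](expRxMexpNx_1 (t * h)) ler_pM2l// expR_ge1Dx.
have : expR (t * h) * (1 + (h - t * h)) <= expR h.
  by rewrite -[in leRHS](subrKC (t * h) h) expRD ler_pM2l// expR_ge1Dx.
move=> H1 H2.
have H3 := ler_wpM2l t0 H1.
have t1' : 0 <= 1 - t by rewrite subr_ge0.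
have H4 := ler_wpM2l t1' H2.
by have := lerD H4 H3; lra.
Qed.

(** * Bounded random variables and Hoeffding's lemma *)

Lemma bounded_measurable_integrable (R : realType) (d : measure_display)
  (T : measurableType d) (P : probability T R) (X : T -> R) (M : R) :
  measurable_fun [set: T] X -> (forall x, `|X x| <= M) ->
  P.-integrable [set: T] (EFin \o X).
Proof.
move=> mX XM; apply: measurable_bounded_integrable => //.
  by rewrite (le_lt_trans (probability_le1 P measurableT)) ?ltry.
exists M; split; first exact: num_real.
by move=> N MN x _; rewrite /= (le_trans (XM x))// ltW.
Qed.

Lemma probability_inhabited (R : realType) (d : measure_display)
  (T : measurableType d) (P : probability T R) : inhabited T.
Proof.
apply: contrapT => T0; have := probability_setT P.
have -> : [set: T] = set0.
  by rewrite -subset0 => x _; apply: T0.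
by rewrite measure0 => /eqP; rewrite eq_sym onee_eq0.
Qed.

Lemma Rintegral_probability_cst (R : realType) (d : measure_display)
  (T : measurableType d) (P : probability T R) (r : R) : \int[P]_(_ in setT) r = r.
Proof. by rewrite Rintegral_cst//= probability_setT mulr1. Qed.

(** Write X = a + c t with t in [0, 1]. The chord bound dominates exp(s X) by a function affine in
    t, whose mean depends only on p = E t: up to the factor exp(s a) it is the moment generating
    function at s c of a Bernoulli variable of mean p, so [bernoulli_mgf_le] concludes. *)
Lemma hoeffding_mgf_le (R : realType) (d : measure_display)
  (T : measurableType d) (P : probability T R) (X : T -> R) (a c s : R) :
  measurable_fun [set: T] X -> (forall x, a <= X x <= a + c) -> 0 <= s ->
  \int[P]_x expR (s * X x) <= expR (s * \int[P]_x X x + s ^+ 2 * c ^+ 2 / 8).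
Proof.
move=> mX aXc s0.
have XM x : `|X x| <= `|a| + `|c|.
  have /andP[aX Xc] := aXc x; rewrite ler_norml; apply/andP; split.
    rewrite (le_trans _ aX)// lerNl (le_trans (ler_norm _))// normrN.
    by rewrite lerDl.
  by rewrite (le_trans Xc)// lerD// ler_norm.
have iX := bounded_measurable_integrable P mX XM.
have [x0] := probability_inhabited P.
have c0 : 0 <= c by have /andP[aX Xc] := aXc x0; lra.
(* The rescaling [t] divides by [c], so the constant case [c = 0] is settled first, with
   equality. *)
move: c0; rewrite le_eqVlt => /predU1P[c0|c0].
  have XE : X = cst a.
    by apply/funext => x; apply: le_anti; have := aXc x; rewrite -c0 addr0 andbC.
  by rewrite XE -c0 expr0n mulr0 mul0r addr0 /cst !Rintegral_probability_cst.
pose t x := (X x - a) / c.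
have t01 x : 0 <= t x <= 1.
  have /andP[aX Xc] := aXc x.
  rewrite /t; apply/andP; split; first by rewrite divr_ge0 ?subr_ge0// ltW.
  by rewrite ler_pdivrMr// mul1r lerBlDl.
have mt : measurable_fun setT t.
  by apply: measurable_funM => //; exact: measurable_funB.
have it : P.-integrable setT (EFin \o t).
  apply: (@bounded_measurable_integrable _ _ _ _ _ 1) => // x.
  by have /andP[? ?] := t01 x; rewrite ger0_norm.
pose p := \int[P]_x t x.
have p01 : 0 <= p <= 1.
  rewrite /p Rintegral_ge0/=; last by move=> x _; have /andP[] := t01 x.
  rewrite -(Rintegral_probability_cst P 1); apply: le_Rintegral => //.
    apply: (@bounded_measurable_integrable _ _ _ _ _ 1) => // x.
    by rewrite normr1.
  by move=> x _; have /andP[] := t01 x.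
have EX : \int[P]_x X x = a + c * p.
  rewrite /p -RintegralZl// -{1}(Rintegral_probability_cst P a) -RintegralD//.
  - apply: eq_Rintegral => x _; rewrite /t mulrCA divff ?gt_eqF// mulr1.
    by rewrite addrC subrK.
  - exact: (@bounded_measurable_integrable _ _ _ _ _ `|a|).
  - by apply: (eq_integrable _ (fun x => c%:E * (t x)%:E)%E) => //; exact: integrableZl.
have -> : s * \int[P]_x X x + s ^+ 2 * c ^+ 2 / 8
    = s * a + (p * (s * c) + (s * c) ^+ 2 / 8).
  by rewrite EX; field.
rewrite expRD.
apply: le_trans (ler_wpM2l (expR_ge0 _) (bernoulli_mgf_le p01 (mulr_ge0 s0 (ltW c0)))).
set E := expR (s * c).
have -> : expR (s * a) * (1 - p + p * E) =
   \int[P]_x (expR (s * a) * (1 + (E - 1) * t x)).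
  rewrite RintegralZl//; last first.
    apply: (@bounded_measurable_integrable _ _ _ _ _ (1 + `|E - 1|)).
      by apply: measurable_funD => //; apply: measurable_funM.
    move=> x; rewrite (le_trans (ler_normD _ _))// normr1 lerD2l normrM.
    by have /andP[? ?] := t01 x; rewrite ler_piMr// ger0_norm.
  rewrite RintegralD//.
  - rewrite Rintegral_probability_cst RintegralZl// -/p; congr (_ * _); ring.
  - by apply: (@bounded_measurable_integrable _ _ _ _ _ 1) => // x; rewrite normr1.
  - by apply: (eq_integrable _ (fun x => (E - 1)%:E * (t x)%:E)%E) => //; exact: integrableZl.
apply: le_Rintegral => //.
- apply: (@bounded_measurable_integrable _ _ _ _ _ (expR (s * (a + c)))).
    by apply: measurableT_comp => //; apply: measurable_funM.
  move=> x; rewrite ger0_norm ?expR_ge0// ler_expR ler_wpM2l//.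
  by have /andP[] := aXc x.
- apply: (@bounded_measurable_integrable _ _ _ _ _ (expR (s * a) * (1 + `|E - 1|))).
    apply: measurable_funM => //.
    by apply: measurable_funD => //; apply: measurable_funM.
  move=> x; rewrite normrM ger0_norm ?expR_ge0// ler_wpM2l ?expR_ge0//.
  rewrite (le_trans (ler_normD _ _))// normr1 lerD2l normrM.
  by have /andP[? ?] := t01 x; rewrite ler_piMr// ger0_norm.
move=> x _.
have -> : s * X x = s * a + t x * (s * c).
  by rewrite /t; field; rewrite gt_eqF.
rewrite expRD ler_wpM2l ?expR_ge0//.
apply: (le_trans (expR_le_chord _ (t01 x))); rewrite -/E; lra.
Qed.

(** * Measures on tuples determined by their values on boxes *)

Definition tuple_box (T : Type) (n : nat) (A : 'I_n -> set T) : set (n.-tuple T) :=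
  [set S | forall i, A i (tnth S i)].

Lemma measurable_tuple_box (d : measure_display) (T : measurableType d)
  (n : nat) (A : 'I_n -> set T) :
  (forall i, measurable (A i)) -> measurable (tuple_box A).
Proof.
move=> mA.
have -> : tuple_box A = \big[setI/setT]_(i < n) ((@tnth n T)^~ i @^-1` A i).
  rewrite -bigcap_seq; apply/seteqP; split=> S /= AS i.
    by move=> _; exact: AS.
  by apply: AS; rewrite /= mem_index_enum.
apply: bigsetI_measurable => i _.
by rewrite -[X in measurable X]setTI; apply: measurable_tnth.
Qed.

(** Boxes intersect side by side, so they form a pi-system. They generate the tuple sigma-algebra
    because a condition on one coordinate is a box whose other sides are full. *)
Lemma tuple_measure_unique (R : realType) (d : measure_display)
  (T : measurableType d) (n : nat)
  (m1 m2 : {measure set (n.-tuple T) -> \bar R}) :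
  (m1 setT < +oo)%E ->
  (forall A : 'I_n -> set T, (forall i, measurable (A i)) ->
    m1 (tuple_box A) = m2 (tuple_box A)) ->
  forall E, measurable E -> m1 E = m2 E.
Proof.
move=> m1fin m12 E mE.
pose G := [set tuple_box A | A in [set A : 'I_n -> set T | forall i, measurable (A i)]].
have boxT : tuple_box (fun _ : 'I_n => [set: T]) = setT.
  by apply/seteqP; split.
have GT : G setT by exists (fun=> setT).
apply: (@g_sigma_algebra_measure_unique _ _ _ G _ (fun=> setT)) => //.
- by move=> _ [A mA <-]; exact: measurable_tuple_box.
- by rewrite bigcup_const.
- move=> _ _ [A mA <-] [B mB <-]; exists (fun i => A i `&` B i).
    by move=> i; exact: measurableI.
  by apply/seteqP; split=> [S AB|S [SA SB] i]; [split=> i; have [] := AB i|].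
- by move=> _ [A mA <-]; exact: m12.
move: E mE; apply: smallest_sub; first exact: smallest_sigma_algebra.
move=> E; rewrite -bigcup_seq => -[i _ [B mB <-]].
apply: sub_sigma_algebra; exists (fun j => if j == i then B else setT).
  by move=> j; case: ifP.
rewrite setTI; apply/seteqP; split => S /=.
  by move=> /(_ i); rewrite eqxx.
by move=> BS j; case: ifPn => // /eqP ->.
Qed.

(** * Splitting off the first coordinate of a product measure *)

Section consing.
Context (R : realType) (d : measure_display) (Z : measurableType d).
Variables (n : nat) (D : probability Z R) (Dm : probability (n.+1.-tuple Z) R).
Hypothesis DmE : is_product_measure D Dm.

Let tl (S : n.+1.-tuple Z) : n.-tuple Z := [tuple of behead S].

Let mtl : measurable_fun setT tl.
Proof. exact: measurable_behead. Qed.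

HB.instance Definition _ := isMeasurableFun.Build _ _ _ _ tl mtl.

(** The marginal of [Dm] on the last [n] coordinates. It serves as the product measure on shorter
    tuples in the induction on length. *)
Definition tuple_tail_measure : probability (n.-tuple Z) R := distribution Dm tl.

Let tnth_tl S j : tnth (tl S) j = tnth S (lift ord0 j).
Proof. by rewrite [in RHS](tuple_eta S) tnthS. Qed.

Let box_cons (A : set Z) (B : 'I_n -> set Z) : 'I_n.+1 -> set Z :=
  fun i => oapp B A (unlift ord0 i).

Let box_consE A B :
  [set S | A (thead S) /\ tuple_box B (tl S)] = tuple_box (box_cons A B).
Proof.
apply/seteqP; split=> S /=.
  move=> [AS BS] i; rewrite /box_cons.
  case: unliftP => [j ->|->] //=.
  by rewrite -tnth_tl; exact: BS.
move=> H; split; first by have := H ord0; rewrite /box_cons unlift_none.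
move=> j; have := H (lift ord0 j); rewrite /box_cons liftK /=.
by rewrite tnth_tl.
Qed.

Let Dm_box_cons A B : measurable A -> (forall i, measurable (B i)) ->
  Dm [set S | A (thead S) /\ tuple_box B (tl S)]
  = (D A * \prod_(i < n) D (B i))%E.
Proof.
move=> mA mB; rewrite box_consE DmE; last first.
  by move=> i; rewrite /box_cons; case: unlift.
rewrite big_ord_recl /box_cons unlift_none /=; congr (_ * _)%E.
by apply: eq_bigr => i _; rewrite liftK.
Qed.

Lemma tuple_tail_measureP : is_product_measure D tuple_tail_measure.
Proof.
move=> B mB.
have := Dm_box_cons (@measurableT _ Z) mB.
rewrite probability_setT mul1e => <-.
rewrite /tuple_tail_measure /= /distribution /pushforward; congr (Dm _).
by apply/seteqP; split=> S //= [].
Qed.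

Let mthead : measurable_fun setT (@thead n Z).
Proof. exact: measurable_tnth. Qed.

Let uncons (S : n.+1.-tuple Z) : Z * n.-tuple Z := (thead S, tl S).

Let muncons : measurable_fun setT uncons.
Proof. exact: measurable_fun_pair. Qed.

HB.instance Definition _ := isMeasurableFun.Build _ _ _ _ uncons muncons.

(** Here [B] is an arbitrary measurable set, not only a box. For fixed [A] both sides are finite
    measures in [B]; they agree on boxes, hence everywhere. *)
Let Dm_rect A (B : set (n.-tuple Z)) : measurable A -> measurable B ->
  distribution Dm uncons (A `*` B) = (D A * tuple_tail_measure B)%E.
Proof.
move=> mA mB.
have mA' : measurable ((@thead n Z) @^-1` A).
  by rewrite -[X in measurable X]setTI; exact: mthead.
pose m1 := pushforward (mrestr Dm mA') tl.
have DA0 : 0 <= fine (D A) by rewrite fine_ge0.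
pose m2 := mscale (NngNum DA0) tuple_tail_measure.
have DAE : (fine (D A))%:E = D A by rewrite fineK ?fin_num_measure.
suff : m1 B = m2 B.
  rewrite /m1 /m2 /pushforward /mrestr /mscale /= DAE => <-.
  rewrite /distribution /pushforward; congr (Dm _).
  by apply/seteqP; split => S /= [].
apply: tuple_measure_unique => //.
  rewrite /= /pushforward /mrestr.
  rewrite (le_lt_trans (probability_le1 _ _)) ?ltry//.
  by rewrite preimage_setT setTI.
move=> C mC.
rewrite /= /m1 /m2 /pushforward /mrestr /mscale /= DAE.
rewrite (tuple_tail_measureP mC) -Dm_box_cons//; congr (Dm _).
by apply/seteqP; split => S /= [].
Qed.

(** By [Dm_rect], [uncons] carries [Dm] to the product of [D] and the tail measure, and Fubini
    applies. The first coordinate is integrated innermost so that the outer integral runs over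
    shorter tuples; the measurability part lets the partial average be fed back into the
    induction. *)
Lemma integral_tuple_cons (G : n.+1.-tuple Z -> R) (M : R) :
  measurable_fun setT G -> (forall S, `|G S| <= M) ->
  measurable_fun setT (fun T : n.-tuple Z => \int[D]_z G [tuple of z :: T]) /\
  \int[Dm]_S G S = \int[tuple_tail_measure]_T \int[D]_z G [tuple of z :: T].
Proof.
move=> mG GM.
pose H (zT : Z * n.-tuple Z) : \bar R := (G [tuple of zT.1 :: zT.2])%:E.
have mH : measurable_fun setT H.
  apply/measurable_EFinP; apply: measurableT_comp => //.
  exact: measurable_cons.
have HM (zT : Z * n.-tuple Z) : `|G [tuple of zT.1 :: zT.2]| <= M by exact: GM.
have iG : Dm.-integrable setT (EFin \o G).
  exact: (bounded_measurable_integrable _ mG GM).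
have HGE : H \o uncons = EFin \o G.
  by apply/funext => S; rewrite /H /= [in RHS](tuple_eta S).
have eqD E : measurable E -> (D \x tuple_tail_measure)%E E = distribution Dm uncons E.
  by move=> mE; apply: product_measure_unique => // A B; exact: Dm_rect.
have iH : (D \x tuple_tail_measure)%E.-integrable setT H.
  apply: measurable_bounded_integrable => //.
  - by rewrite [ltLHS](eqD _ measurableT) [ltLHS]probability_setT ltry.
  - exact/measurable_EFinP.
  - exists M; split; first exact: num_real.
    by move=> N MN x _; rewrite /= (le_trans (HM x))// ltW.
have GE : fubini_G D H = EFin \o (fun T : n.-tuple Z => \int[D]_z G [tuple of z :: T]).
  apply/funext => T; rewrite /fubini_G /H /= /Rintegral fineK//.
  apply: integrable_fin_num => //.
  apply: (@bounded_measurable_integrable _ _ _ _ _ M) => //.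
  apply: measurableT_comp => //; exact: measurable_cons.
split.
  by apply/measurable_EFinP; rewrite -GE; exact: measurable_fubini_G iH.
rewrite /Rintegral; congr fine.
have := integral21_prod_meas1 iH; rewrite GE => ->.
rewrite (eq_measure_integral (distribution Dm uncons)); last first.
  by move=> A mA _; exact: eqD.
rewrite integral_distribution ?HGE//.
Qed.

End consing.

(** * Functions with bounded differences *)

Lemma replace_at_cons0 (Z : Type) (n : nat) (z z' : Z) (T : n.-tuple Z) :
  replace_at [tuple of z :: T] ord0 z' = [tuple of z' :: T].
Proof.
apply: eq_from_tnth => i; rewrite tnth_mktuple.
case: (unliftP ord0 i) => [j ->|->]; last by rewrite eqxx.
by rewrite !tnthS.
Qed.

Lemma replace_at_consS (Z : Type) (n : nat) (z z' : Z) (T : n.-tuple Z) (i : 'I_n) :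
  replace_at [tuple of z :: T] (lift ord0 i) z' = [tuple of z :: replace_at T i z'].
Proof.
apply: eq_from_tnth => k; rewrite tnth_mktuple.
case: (unliftP ord0 k) => [j ->|->]; last by [].
by rewrite !tnthS tnth_mktuple (inj_eq lift_inj).
Qed.

Definition bounded_differences (R : realType) (Z : Type) (m : nat)
    (g : m.-tuple Z -> R) (c : 'I_m -> R) :=
  forall i S z', `|g S - g (replace_at S i z')| <= c i.

Lemma bounded_differences_cons (R : realType) (Z : Type) (n : nat)
  (g : n.+1.-tuple Z -> R) (c : 'I_n.+1 -> R) (z : Z) :
  bounded_differences g c ->
  bounded_differences (fun T : n.-tuple Z => g [tuple of z :: T])
    (fun i => c (lift ord0 i)).
Proof. by move=> gc i T z'; rewrite -replace_at_consS; exact: gc. Qed.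

(** One sample is turned into the other coordinate by coordinate: changing the head costs [c ord0],
    then the tails are compared under a common head. *)
Lemma bounded_differences_dist (R : realType) (Z : Type) (m : nat)
  (g : m.-tuple Z -> R) (c : 'I_m -> R) : bounded_differences g c ->
  forall S S', `|g S - g S'| <= \sum_(i < m) c i.
Proof.
elim: m g c => [|n IH] g c gc S S'.
  by rewrite (tuple0 S) (tuple0 S') subrr normr0 big_ord0.
rewrite (tuple_eta S) (tuple_eta S') big_ord_recl.
set z := thead S; set z' := thead S'; set T := [tuple of behead S].
rewrite (le_trans (ler_distD (g [tuple of z' :: T]) _ _))// lerD//.
  by rewrite -(replace_at_cons0 z z' T); exact: gc.
exact: (IH _ _ (bounded_differences_cons z' gc)).
Qed.

(** This uniform bound is the source of integrability for [g], its partial averages and their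
    exponentials. *)
Lemma bounded_differences_bounded (R : realType) (Z : Type) (m : nat)
  (g : m.-tuple Z -> R) (c : 'I_m -> R) (S0 : m.-tuple Z) :
  bounded_differences g c -> forall S, `|g S| <= `|g S0| + \sum_(i < m) c i.
Proof.
move=> gc S; rewrite addrC -lerBlDr.
by rewrite (le_trans (lerB_dist _ _))// (bounded_differences_dist gc).
Qed.

(** * McDiarmid's inequality *)

(** Averaging [g] over its first coordinate gives [g1], which has the same mean and the remaining
    difference constants. Hoeffding's lemma with the tail frozen bounds the inner integral by [K]
    times exp(s g1), and the induction hypothesis handles [g1]. *)
Lemma mcdiarmid_mgf_le (R : realType) (d : measure_display)
  (Z : measurableType d) (m : nat) (D : probability Z R)
  (Dm : probability (m.-tuple Z) R) (g : m.-tuple Z -> R) (c : 'I_m -> R) (s : R) :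
  is_product_measure D Dm -> measurable_fun setT g ->
  bounded_differences g c -> 0 <= s ->
  \int[Dm]_S expR (s * g S) <=
  expR (s * \int[Dm]_S g S + s ^+ 2 * (\sum_(i < m) c i ^+ 2) / 8).
Proof.
elim: m Dm g c => [|n IH] Dm g c DmE mg gc s0.
  have -> : g = cst (g [tuple]) by apply/funext => S; rewrite (tuple0 S).
  by rewrite /cst !Rintegral_probability_cst big_ord0 mulr0 mul0r addr0.
have [S0] := probability_inhabited Dm.
pose M : R := `|g S0| + \sum_(i < n.+1) c i.
have gM := bounded_differences_bounded S0 gc.
have mgT (T : n.-tuple Z) : measurable_fun setT (fun z => g [tuple of z :: T]).
  by apply: measurableT_comp => //; exact: measurable_cons.
have igT (T : n.-tuple Z) : D.-integrable setT (EFin \o (fun z => g [tuple of z :: T])).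
  by apply: (@bounded_measurable_integrable _ _ _ _ _ M).
pose g1 (T : n.-tuple Z) : R := \int[D]_z g [tuple of z :: T].
pose c1 i := c (lift ord0 i).
have [mg1 Eg] := integral_tuple_cons DmE mg gM.
have mexp : measurable_fun setT (fun S => expR (s * g S)).
  by apply: measurableT_comp => //; exact: measurable_funM.
have expM S : `|expR (s * g S)| <= expR (s * M).
  rewrite ger0_norm ?expR_ge0// ler_expR ler_wpM2l//.
  by rewrite (le_trans (ler_norm _)).
have [mexp1 ->] := integral_tuple_cons DmE mexp expM.
(* A difference of averages is the average of the differences, each bounded by [c1 i]. *)
have g1c : bounded_differences g1 c1.
  move=> i T z'; rewrite /g1 -RintegralB//.
  apply: (le_trans (le_normr_Rintegral _ _)) => //.
    apply: (@bounded_measurable_integrable _ _ _ _ _ (c1 i)).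
      exact: measurable_funB.
    by move=> z; exact: (bounded_differences_cons z gc).
  rewrite -[leRHS](Rintegral_probability_cst D); apply: le_Rintegral => //.
  - apply: (@bounded_measurable_integrable _ _ _ _ _ (c1 i)).
      by apply: measurableT_comp => //; exact: measurable_funB.
    by move=> z; rewrite normr_id; exact: (bounded_differences_cons z gc).
  - exact: (@bounded_measurable_integrable _ _ _ _ _ `|c1 i|).
  - by move=> z _; exact: (bounded_differences_cons z gc).
have [T0] := probability_inhabited (tuple_tail_measure Dm).
have g1M := bounded_differences_bounded T0 g1c.
pose K := expR (s ^+ 2 * c ord0 ^+ 2 / 8).
have step (T : n.-tuple Z) : \int[D]_z expR (s * g [tuple of z :: T]) <= K * expR (s * g1 T).
  rewrite /K -expRD addrC.
  (* With [T] fixed, any two values differ by at most [c ord0], so all lie in an interval of that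
     length starting at their infimum. Centring at a single value would double the length. *)
  pose a := inf (range (fun z => g [tuple of z :: T])).
  have [z0] := probability_inhabited D.
  have hinf : has_inf (range (fun z => g [tuple of z :: T])).
    split; first by exists (g [tuple of z0 :: T]), z0.
    exists (- M) => _ [z _ <-].
    by have := gM [tuple of z :: T]; rewrite ler_norml => /andP[].
  apply: (@hoeffding_mgf_le _ _ _ _ _ a) => // z; apply/andP; split.
    by apply: ge_inf; [case: hinf|exists z].
  rewrite -lerBlDr; apply: lb_le_inf; first by case: hinf.
  move=> _ [z' _ <-]; rewrite lerBlDl -lerBlDr.
  by rewrite (le_trans (ler_norm _))// -(replace_at_cons0 z z' T); exact: gc.
have mexpg1 : measurable_fun setT (fun T => expR (s * g1 T)).
  by apply: measurableT_comp => //; exact: measurable_funM.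
have iexpg1 : (tuple_tail_measure Dm).-integrable setT
    (EFin \o (fun T => expR (s * g1 T))).
  apply: (@bounded_measurable_integrable _ _ _ _ _
    (expR (s * (`|g1 T0| + \sum_(i < n) c1 i)))) => // T.
  rewrite ger0_norm ?expR_ge0// ler_expR ler_wpM2l//.
  by rewrite (le_trans (ler_norm _)).
apply: (@le_trans _ _ (\int[tuple_tail_measure Dm]_T (K * expR (s * g1 T)))).
  apply: le_Rintegral => //.
  - apply: (@bounded_measurable_integrable _ _ _ _ _ (expR (s * M))) => // T.
    rewrite ger0_norm; last by apply: Rintegral_ge0 => z _; exact: expR_ge0.
    rewrite -(Rintegral_probability_cst D (expR (s * M))).
    apply: le_Rintegral => //.
    + apply: (@bounded_measurable_integrable _ _ _ _ _ (expR (s * M))) => //.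
      by apply: measurableT_comp => //; exact: measurable_funM.
    + apply: (@bounded_measurable_integrable _ _ _ _ _ (expR (s * M))) => // _.
      by rewrite ger0_norm ?expR_ge0.
    + by move=> z _; rewrite (le_trans (ler_norm _)).
  - by apply: (eq_integrable _ (fun T => K%:E * (expR (s * g1 T))%:E)%E) => //;
      exact: integrableZl.
rewrite RintegralZl//.
have := IH _ g1 c1 (tuple_tail_measureP DmE) mg1 g1c s0.
move=> /(ler_wpM2l (expR_ge0 (s ^+ 2 * c ord0 ^+ 2 / 8))).
rewrite -/K => /le_trans; apply.
rewrite /K -expRD ler_expR Eg big_ord_recl /c1 -/(g1 _).
rewrite le_eqVlt; apply/orP; left; apply/eqP.
by rewrite -/g1; field.
Qed.

Lemma mcdiarmid (R : realType) (d : measure_display)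
  (Z : measurableType d) (m : nat) (D : probability Z R)
  (Dm : probability (m.-tuple Z) R) (g : m.-tuple Z -> R) (c : 'I_m -> R)
  (delta : R) :
  is_product_measure D Dm -> measurable_fun setT g ->
  bounded_differences g c -> 0 < delta <= 1 ->
  ((1 - delta)%:E <= Dm [set S | (g S <= \int[Dm]_S' g S'
     + Num.sqrt (ln (1 / delta) / 2 * \sum_(i < m) c i ^+ 2))%R])%E.
Proof.
move=> DmE mg gc /andP[delta0 delta1].
set C := \sum_(i < m) c i ^+ 2; set t := Num.sqrt _; set A := [set S | _].
have mA : measurable A.
  rewrite -[A]setTI; exact: measurable_fun_le.
have C0 : 0 <= C by apply: sumr_ge0 => i _; exact: sqr_ge0.
have l0 : 0 <= ln (1 / delta) by rewrite ln_ge0// ler_pdivlMr// mul1r.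
(* At [delta = 1] the claimed probability is 0. Below 1 the logarithm is positive, which makes [t],
   and then the Chernoff parameter, positive. *)
move: delta1; rewrite le_eqVlt => /predU1P[->|delta1].
  by rewrite subrr measure_ge0.
have [S0] := probability_inhabited Dm.
(* If [C = 0], every [c i] vanishes and [g] is constant; otherwise division by [C] is legitimate. *)
move: C0; rewrite le_eqVlt => /predU1P[C0|C0].
  have gE S : g S = g S0.
    apply/eqP; rewrite -subr_eq0 -normr_le0.
    rewrite (le_trans (bounded_differences_dist gc S S0))//.
    rewrite big1// => i _; apply/eqP; rewrite -sqrf_eq0.
    have /psumr_eq0P : C = 0 by [].
    by rewrite /C => -> //= j _; exact: sqr_ge0.
  have -> : A = setT.
    apply/seteqP; split => // S _; rewrite /A /=.
    under eq_Rintegral do rewrite gE.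
    by rewrite Rintegral_probability_cst (gE S) lerDl sqrtr_ge0.
  by rewrite probability_setT lee_fin gerBl ltW.
have {}l0 : 0 < ln (1 / delta) by rewrite ln_gt0// ltr_pdivlMr// mul1r.
have t2 : t ^+ 2 = ln (1 / delta) / 2 * C.
  by rewrite sqr_sqrtr// mulr_ge0 ?divr_ge0 ?ltW.
have t0 : 0 < t by rewrite sqrtr_gt0 mulr_gt0 ?divr_gt0.
(* This [s] minimises s^2 C / 8 - s t. The minimum is -2 t^2 / C, which equals -ln(1 / delta) by
   [t2]. *)
pose s := 4 * t / C.
have s0 : 0 < s by rewrite divr_gt0// mulr_gt0.
set mu := \int[Dm]_S' g S'.
suff ub : (Dm (~` A) <= delta%:E)%E.
  move: ub; rewrite probability_setC// leeBlDl ?fin_num_measure//.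
  by rewrite EFinB leeBlDr// addeC.
pose X : {RV Dm >-> R} := mfun_Sub (mem_set mg).
apply: (@le_trans _ _ (Dm [set S | mu + t <= X S])).
  apply: le_measure; rewrite ?inE.
  - exact: measurableC.
  - by rewrite -[X in measurable X]setTI; exact: measurable_fun_le.
  - by move=> S; rewrite /A /= => /negP; rewrite -ltNge => /ltW.
apply: (le_trans (chernoff X (mu + t) s0)).
have ME : ('M_Dm X s)%E = (\int[Dm]_S expR (s * g S))%:E.
  rewrite /mmt_gen_fun unlock /Rintegral fineK.
    by apply: eq_integral => S _; rewrite /= mulrC.
  apply: integrable_fin_num => //.
  apply: (@bounded_measurable_integrable _ _ _ _ _
    (expR (s * (`|g S0| + \sum_(i < m) c i)))).
    by apply: measurableT_comp => //; exact: measurable_funM.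
  move=> S; rewrite ger0_norm ?expR_ge0// ler_expR ler_wpM2l ?(ltW s0)//.
  by rewrite (le_trans (ler_norm _))// (bounded_differences_bounded S0 gc).
rewrite ME -EFinM lee_fin.
have := mcdiarmid_mgf_le DmE mg gc (ltW s0).
move=> /(ler_wpM2r (expR_ge0 (- (s * (mu + t))))) /le_trans; apply.
rewrite -expRD -/mu -/C.
have -> : s * mu + s ^+ 2 * C / 8 - s * (mu + t) = - ln (1 / delta).
  have -> : ln (1 / delta) = 2 * t ^+ 2 / C.
    by rewrite t2; field; rewrite gt_eqF.
  by rewrite /s; field; rewrite gt_eqF.
by rewrite mul1r lnV ?posrE// opprK lnK ?posrE.
Qed.

(** * The bound holding simultaneously for every posterior *)

Unset Implicit Arguments.

Theorem theorem3p2 (R : realType)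
  (dH : measure_display) (H : measurableType dH)
  (dZ : measure_display) (Z : measurableType dZ)
  (m : nat) (D : probability Z R) (Dm : probability (m.-tuple Z) R)
  (I : interval R) (f : R -> R) (Gamma : set (H -> R))
  (P : probability H R) (delta : R)
  (phi : m.-tuple Z -> H -> R) (B : (H -> R) -> R) (c : 'I_m -> R) :
  is_product_measure D Dm ->
  convex_function ([set` I] : set R^o) (f : R^o -> R^o) ->
  Gamma `<=` @Mb _ H R ->
  0 < delta <= 1 ->
  (forall S, Gamma (phi S)) ->
  (forall S, (LambdaP I f P (phi S) <= (B (phi S))%:E)%E) ->
  measurable_fun [set: m.-tuple Z] (fun S => B (phi S)) ->
  (forall (i : 'I_m) (S : m.-tuple Z) (z' : Z),
      `|B (phi S) - B (phi (replace_at S i z'))| <= c i) ->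
  exists A : set (m.-tuple Z),
    [/\ measurable A, ((1 - delta)%:E <= Dm A)%E &
    forall S, A S -> forall rho : probability H R,
      (\int[rho]_h (phi S h)%:E <=
         fGammaDiv I f Gamma rho P
         + \int[Dm]_S' (B (phi S'))%:E
         + (Num.sqrt (ln (1 / delta) / 2 * \sum_(i < m) c i ^+ 2))%:E)%E].
Proof.
move=> DmE _ GammaMb delta01 Gphi LB mB Bc.
pose g S := B (phi S).
have [S0] := probability_inhabited Dm.
have ig : Dm.-integrable setT (EFin \o g).
  exact: (bounded_measurable_integrable Dm mB
    (bounded_differences_bounded S0 (Bc : bounded_differences g c))).
(* The event comes from [mcdiarmid] and involves only [g], so it is fixed before [rho] is chosen. *)
eexists; split; last 2 first.
- exact: (mcdiarmid DmE mB Bc delta01).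
- move=> S /= gS rho.
  (* Boundedness makes the mean of [phi S] under [rho] a finite real, so [g S] can be subtracted and
     added back even when the divergence is infinite. *)
  have [mphi [M phiM]] := GammaMb _ (Gphi S).
  have iphi := bounded_measurable_integrable rho mphi phiM.
  have phi_fin := integrable_fin_num measurableT iphi.
  have D_ge : (\int[rho]_h (phi S h)%:E - (g S)%:E
      <= fGammaDiv I f Gamma rho P)%E.
    apply: (@le_trans _ _ (\int[rho]_h (phi S h)%:E - LambdaP I f P (phi S))%E).
      by rewrite leeB.
    by apply: ereal_sup_ubound; exists (phi S).
  have -> : (\int[Dm]_S' (B (phi S'))%:E = (\int[Dm]_S' g S')%:E)%E.
    by rewrite /Rintegral fineK//; exact: integrable_fin_num.
  rewrite -addeA -EFinD.
  apply: le_trans (leeD D_ge (lexx _)).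
  rewrite -(fineK phi_fin) -EFinB -EFinD lee_fin -addrA lerDl.
  by rewrite addrC subr_ge0.
- rewrite -[X in measurable X]setTI.
  exact: measurable_fun_ler.
Qed.
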